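(* Let $R$ be a unital $*$-ring and let $a,b\in R$ be core invertible with $b\,b^{(\#)}a=ab\,b^{(\#)}$. Then the following are equivalent: (i) $ab$ is core invertible and $(ab)^{(\#)}=a^{(\#)}b^{(\#)}$; (ii) $ab$ is group invertible, $a\,b^{(\#)}R\subseteq a^{(\#)}b^{(\#)}R$, and $a^*b^{(\#)}\bigl(1-(ab\,a^{(\#)}b^{(\#)})^*\bigr)b=0$.
   Context: A unital $*$-ring is an associative ring $R$ with unity $1$ equipped with an involution $*:R\to R$ satisfying $(a+b)^*=a^*+b^*$, $(ab)^*=b^*a^*$ and $(a^* )^*=a$ for all $a,b\in R$. An element $a\in R$ is core invertible if there exists $x\in R$ with $axa=a$, $xax=x$, $(ax)^*=ax$, $xa^2=a$ and $ax^2=x$; such an $x$ is unique when it exists, is called the core inverse of $a$, and is denoted $a^{(\#)}$. An element $a\in R$ is group invertible if there exists $x\in R$ with $xa^2=a$, $ax=xa$ and $ax^2=x$. For $c\in R$, $cR=\{cr: r\in R\}$. *)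

(* Defs.v *)
From HB Require Import structures.
From mathcomp Require Import all_boot all_algebra.
From mathcomp Require Import boolp classical_sets.

Set Implicit Arguments.
Unset Strict Implicit.
Unset Printing Implicit Defensive.

Import GRing.Theory.
Local Open Scope ring_scope.

(* The base is [pzRingType], so the zero ring is allowed. *)
HB.mixin Record PzRing_isStarRing R of GRing.PzRing R := {
  star : R -> R;
  starD : {morph star : a b / a + b};
  starM : forall a b, star (a * b) = star b * star a;
  starK : involutive star
}.

#[short(type="starRingType")]
HB.structure Definition StarRing := {R of GRing.PzRing R & PzRing_isStarRing R}.

Section CoreInverse.
Variable R : starRingType.
Implicit Types a b c x y : R.

Definition is_core_inverse a x : Prop :=
  [/\ a * x * a = a, x * a * x = x, star (a * x) = a * x,
      x * a ^+ 2 = a & a * x ^+ 2 = x].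

Definition core_invertible a : Prop := exists x, is_core_inverse a x.

(* Junk value 0 when a is not core invertible. *)
Definition core_inverse a : R := xget 0 [set x | is_core_inverse a x]%classic.

Definition is_group_inverse a x : Prop :=
  [/\ x * a ^+ 2 = a, a * x = x * a & a * x ^+ 2 = x].

Definition group_invertible a : Prop := exists x, is_group_inverse a x.

Definition right_ideal c : set R := [set c * r | r in [set: R]]%classic.

Lemma is_core_inverse_uniq a x y :
  is_core_inverse a x -> is_core_inverse a y -> x = y.
Proof.
move=> [axa xax hx xa2 ax2] [aya yay hy ya2 ay2].
have e : a * x = a * y.
  by rewrite -hx -{1}aya -(mulrA (a * y)) starM hx hy mulrA axa.
have xay : x * (a * y) = y by rewrite -{1}ay2 (mulrA a) -expr2 mulrA xa2.
by rewrite -[RHS]xay -e mulrA xax.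
Qed.

Lemma core_inverseP a : core_invertible a -> is_core_inverse a (core_inverse a).
Proof.
move=> [x ax]; rewrite /core_inverse; case: xgetP => [y _ //|].
by move=> /(_ x) /(_ ax).
Qed.

Lemma core_inverse_eq a x : is_core_inverse a x -> core_inverse a = x.
Proof.
by move=> ax; apply: (is_core_inverse_uniq _ ax); apply: core_inverseP; exists x.
Qed.

End CoreInverse.

(* Main.v *)
Require Import Defs.
From mathcomp Require Import all_boot all_algebra.
From mathcomp Require Import boolp classical_sets.
Import GRing.Theory.
Local Open Scope ring_scope.

(** Write [x], [y] for the core inverses of [a], [b], and put [A = a * b],
    [z = x * y], [q = A * z].  Since [b * y] fixes [b] on the left and commutes
    with [a], it fixes [A], hence [q]: so [b * y * q = q].

    The elements [star a] and [x] have the same right annihilator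
    ([star_core_inverse_annihilator]), so the last condition of (ii) says
    [z * (1 - star q) * b = 0].  Multiplying it by [y] on the right, and using
    that [b * y] is self-adjoint and fixes [z] and [star q] on the right, turns
    it into [z * star q = z].  This forces [q = q * star q], whence [q] is
    self-adjoint and [z * A * z = z]; conversely these two identities give
    [z * star q = z].

    The inclusion of right ideals says that [a * y] is a right multiple of [z],
    which, once [z * A * z = z], means [z * A * a * y = a * y]; multiplied by
    [b ^+ 2] on the right, this is [z * A ^+ 2 = A].  For a group invertible [A]
    the three identities obtained characterize the core inverse
    ([group_invertible_core_inverse]).  The converse directions come from the
    fact that a core inverse of [A] generates the same right ideal as [A]. *)

Section StarRing.
Set Implicit Arguments.
Unset Strict Implicit.
Variable R : starRingType.
Implicit Types a b x y z u : R.

(** The group inverse is the one expressed through the core inverse [z] as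
    [z ^+ 2 * a]. *)
Lemma core_invertible_group_invertible a :
  core_invertible a -> group_invertible a.
Proof.
move=> [z [aza zaz _ za2 az2]]; exists (z ^+ 2 * a).
rewrite !expr2 in za2 az2 *.
have zzaa : z * z * a * a = z * a by rewrite -!mulrA za2.
have azza : a * (z * z * a) = z * a by rewrite mulrA az2.
split.
- by rewrite mulrA zzaa -mulrA.
- by rewrite azza.
- by rewrite mulrA azza !mulrA zaz.
Qed.

(** Group invertibility lets [a] be cancelled from [z * a ^+ 2 = a], which
    supplies both [a * z * a = a] and the membership of [z] in the right ideal
    of [a], hence the two missing equations. *)
Lemma group_invertible_core_inverse a z :
  group_invertible a -> z * a * z = z -> star (a * z) = a * z ->
  z * a ^+ 2 = a -> is_core_inverse a z.
Proof.
move=> [g [ga2 ag _]] zaz hz za2.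
rewrite !expr2 in ga2 za2.
have aag : a * a * g = a by rewrite -mulrA ag mulrA ag -mulrA.
have aza : a * z * a = a.
  by rewrite -{2}aag mulrA -[a * z * (a * a)]mulrA za2 aag.
have zE : z = a * g * z.
  by rewrite -{1}zaz -{1}aag mulrA za2.
split; rewrite ?expr2 //.
by rewrite mulrA {2}zE !mulrA aza -zE.
Qed.

(** Each of [star a], [x] is a left multiple of the other:
    [star a = star a * a * x] and [x = x * star x * star a]. *)
Lemma star_core_inverse_annihilator a x u :
  is_core_inverse a x -> (star a * u = 0 <-> x * u = 0).
Proof.
move=> [axa xax hx _ _]; split=> u0.
- by rewrite -xax -(mulrA x a x) -hx starM -!mulrA u0 !mulr0.
- by rewrite -axa starM hx -!mulrA u0 !mulr0.
Qed.

Lemma core_inverse_right_ideal a z :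
  is_core_inverse a z -> right_ideal z = right_ideal a.
Proof.
move=> [_ _ _ za2 az2]; apply/seteqP; split=> _ [r _ <-].
- by exists (z ^+ 2 * r) => //; rewrite mulrA az2.
- by exists (a ^+ 2 * r) => //; rewrite mulrA za2.
Qed.

(** The right factor [b] is as good as the projection [b * y], which fixes both
    [z = x * y] and [star (a * b * z)] on the right. *)
Lemma star_condition_fixes a b x y :
  is_core_inverse a x -> is_core_inverse b y ->
  b * y * a = a * b * y ->
  (star a * y * (1 - star (a * b * x * y)) * b = 0
   <-> x * y * star (a * b * x * y) = x * y).
Proof.
move=> ax [byb yby hy _ _] comm.
have pq : b * y * (a * b * x * y) = a * b * x * y.
  by rewrite !mulrA comm -!(mulrA a) byb.
have qp : star (a * b * x * y) * (b * y) = star (a * b * x * y).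
  by rewrite -{1}hy -starM pq.
have zp : x * y * (b * y) = x * y by rewrite -mulrA (mulrA y) yby.
set s := star _ in qp *.
rewrite -!mulrA (star_core_inverse_annihilator _ ax) !mulrA; split=> [h0|zs].
- have : x * y * (1 - s) * (b * y) = 0 by rewrite mulrA h0 mul0r.
  by rewrite mulrBr mulr1 mulrBl zp -[_ * s * _]mulrA qp => /subr0_eq <-.
- by rewrite mulrBr mulr1 zs subrr mul0r.
Qed.

(** If [z = z * star (a * z)] then [a * z = (a * z) * star (a * z)], and the
    right-hand side is self-adjoint. *)
Lemma fixed_by_star_iff a z :
  z * star (a * z) = z <-> (star (a * z) = a * z /\ z * a * z = z).
Proof.
split=> [zq|[-> zaz]]; last by rewrite mulrA.
have qq : a * z * star (a * z) = a * z by rewrite -[LHS]mulrA zq.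
have hq : star (a * z) = a * z by rewrite -qq starM starK.
by split=> //; rewrite -mulrA -hq.
Qed.

End StarRing.

Theorem theorem3p4 (R : starRingType) (a b : R)
    (ha : core_invertible a) (hb : core_invertible b)
    (hab : b * core_inverse b * a = a * b * core_inverse b) :
  (core_invertible (a * b) /\
     core_inverse (a * b) = core_inverse a * core_inverse b)
  <->
  [/\ group_invertible (a * b),
      (right_ideal (a * core_inverse b)
         `<=` right_ideal (core_inverse a * core_inverse b))%classic &
      star a * core_inverse b
        * (1 - star (a * b * core_inverse a * core_inverse b)) * b = 0].
Proof.
have ax := core_inverseP ha; have yb := core_inverseP hb.
rewrite (propext (star_condition_fixes ax yb hab)).
move: (core_inverse a) (core_inverse b) ax yb {hab} => x y ax yb.
rewrite -(mulrA (a * b)) (propext (fixed_by_star_iff _ _)).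
have [_ _ _ yb2 by2] := yb.
split=> [[cab zE]|[gab sub [hq zaz]]].
- have zab := core_inverseP cab; rewrite zE in zab.
  have [_ zaz hq _ _] := zab.
  split=> //; first exact: core_invertible_group_invertible.
  rewrite (core_inverse_right_ideal zab) => _ [r _ <-].
  by exists (y ^+ 2 * r) => //; rewrite mulrA -(mulrA a b) by2.
- suff zab : is_core_inverse (a * b) (x * y).
    by split; [exists (x * y) | apply: core_inverse_eq].
  apply: group_invertible_core_inverse => //.
  have [r _ zr] : right_ideal (x * y) (a * y).
    by apply: sub; exists 1; rewrite ?mulr1.
  have zay : x * y * (a * b) * (a * y) = a * y by rewrite -zr mulrA zaz.
  have abE : a * b = a * y * b ^+ 2 by rewrite -mulrA yb2.
  by rewrite expr2 mulrA {2}abE mulrA zay -abE.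
Qed.
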